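(* Let $I\subset\mathbb{R}$ be an interval with interior $I^{\circ}$, let $f:I\to\mathbb{R}$ be twice differentiable on $I^{\circ}$, and let $a,b\in I^{\circ}$ with $a<b$. Let $q\ge 1$ be real and suppose that $|f''|^q$ is $P$-convex on $[a,b]$. Then $$\left|\frac13\left[\frac{f(a)+f(b)}{2}+2f\left(\frac{a+b}{2}\right)\right]-\frac{1}{b-a}\int_a^b f(x)\,dx\right|\le\frac{(b-a)^2}{162}\bigl(|f''(a)|^q+|f''(b)|^q\bigr)^{1/q}.$$
   Context: A function $g:J\to\mathbb{R}$ on an interval $J\subseteq\mathbb{R}$ is called $P$-convex (or a $P$-function) if it is nonnegative and $g(\mu x+(1-\mu)y)\le g(x)+g(y)$ for all $x,y\in J$ and all $\mu\in[0,1]$. *)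

(* Defs.v *)
From mathcomp Require Import all_boot all_order all_algebra.
From mathcomp Require Import all_classical all_reals all_analysis.

Set Implicit Arguments.
Unset Strict Implicit.
Unset Printing Implicit Defensive.

Import Order.TTheory GRing.Theory Num.Theory.
Import numFieldNormedType.Exports.

Local Open Scope ring_scope.
Local Open Scope classical_set_scope.

(* A function on [J] is represented by a total function [R -> R] of which only
   the values on [J] are constrained. *)
Definition P_convex (R : realType) (J : interval R) (g : R -> R) : Prop :=
  (forall x, x \in J -> 0 <= g x) /\
  (forall x y mu, x \in J -> y \in J -> 0 <= mu <= 1 ->
     g (mu * x + (1 - mu) * y) <= g x + g y).

(* As [f^`(2)] is a total function, the existence of both derivatives has to be
   required explicitly; for [U] open, only the values of [f] on [U] matter. *)
Definition twice_derivable_on (R : realType) (U : set R) (f : R -> R) : Prop :=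
  forall x, U x -> derivable f x 1 /\ derivable f^`() x 1.

(* Main.v *)
Require Import Defs.
From mathcomp Require Import all_boot all_order all_algebra.
From mathcomp Require Import all_classical all_reals all_analysis.
From mathcomp Require Import ring lra.

Import Order.TTheory GRing.Theory Num.Theory.
Import numFieldNormedType.Exports.

Local Open Scope ring_scope.
Local Open Scope classical_set_scope.

(* With [m] the midpoint and [h = (b - a) / 2], the error depends on [f] only
   through [F t = f (m + t) + f (m - t)] on [0, h], and does not change when a
   multiple of [t ^ 2] is added to [F]; so it is controlled by the distance of
   [F''] to the constants. For an arbitrary [f''] bounded by [K] this only gives
   the constant 1/81. The factor 2 is gained as follows: by [P]-convexity
   [|f''|] is monotone on both sides of each of its zeros, so by Darboux's
   theorem [f''] either has constant sign or is monotone, and in both cases [F'']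
   stays within [K] of a constant. *)

(** * Differentiation rules, growth bounds from derivative bounds, and Darboux's theorem *)

Section Derivatives.
Set Implicit Arguments.
Unset Strict Implicit.
Context {R : realType}.
Implicit Types (f g phi : R -> R) (x a b c d m : R).

(* The library states these rules for sums and products of functions; the
   pointwise forms unify with explicit lambda terms. *)
Lemma is_derive_idfun x : is_derive x 1 (fun t : R => t) 1.
Proof. exact: is_derive_id. Qed.

Lemma is_derive_const x c : is_derive x 1 (fun _ : R => c) 0.
Proof. exact: is_derive_cst. Qed.

Lemma is_derive_add f g x a b : is_derive x 1 f a -> is_derive x 1 g b ->
  is_derive x 1 (fun t => f t + g t) (a + b).
Proof. by move=> fa gb; exact: is_deriveD. Qed.

Lemma is_derive_sub f g x a b : is_derive x 1 f a -> is_derive x 1 g b ->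
  is_derive x 1 (fun t => f t - g t) (a - b).
Proof. by move=> fa gb; exact: is_deriveB. Qed.

Lemma is_derive_opp f x a : is_derive x 1 f a -> is_derive x 1 (fun t => - f t) (- a).
Proof. by move=> fa; exact: is_deriveN. Qed.

Lemma is_derive_mul f g x a b : is_derive x 1 f a -> is_derive x 1 g b ->
  is_derive x 1 (fun t => f t * g t) (a * g x + f x * b).
Proof.
move=> fa gb; apply: (is_derive_eq (is_deriveM fa gb)).
by rewrite addrC -![_ *: _]/(_ * _) [g x * _]mulrC.
Qed.

Lemma is_derive_scale f x k a : is_derive x 1 f a ->
  is_derive x 1 (fun t => k * f t) (k * a).
Proof.
move=> fa; apply: (is_derive_eq (is_derive_mul (is_derive_const x k) fa)).
by rewrite mul0r add0r.
Qed.

Lemma is_derive_pow f n x a : is_derive x 1 f a ->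
  is_derive x 1 (fun t => f t ^+ n) (n%:R * f x ^+ n.-1 * a).
Proof.
move=> fa; rewrite (_ : (fun t => _) = f ^+ n); first exact: is_deriveX.
by rewrite exprfctE.
Qed.

Lemma is_derive_comp_add f m x a : is_derive (m + x) 1 f a ->
  is_derive x 1 (fun t => f (m + t)) a.
Proof.
move=> fa; have d : is_derive x 1 (fun t => m + t) 1.
  by apply: (is_derive_eq (is_derive_add (is_derive_const x m) (is_derive_idfun x)));
    rewrite add0r.
by apply: (is_derive_eq (@is_derive1_comp _ f (fun t => m + t) x a 1 fa d)); rewrite mulr1.
Qed.

Lemma is_derive_comp_sub f m x a : is_derive (m - x) 1 f a ->
  is_derive x 1 (fun t => f (m - t)) (- a).
Proof.
move=> fa; have d : is_derive x 1 (fun t => m - t) (- 1).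
  by apply: (is_derive_eq (is_derive_sub (is_derive_const x m) (is_derive_idfun x)));
    rewrite sub0r.
by apply: (is_derive_eq (@is_derive1_comp _ f (fun t => m - t) x a (- 1) fa d)); rewrite mulrN1.
Qed.

Lemma derivable_is_derive1 f x : derivable f x 1 -> is_derive x 1 f (f^`() x).
Proof. by move=> fx; split=> //; rewrite derive1E. Qed.

Lemma is_derive_continuous f x a : is_derive x 1 f a -> {for x, continuous f}.
Proof. by case=> fx _; exact/differentiable_continuous/derivable1_diffP. Qed.

Lemma is_derive_within_continuous f (df : R -> R) a b :
  (forall x, a <= x <= b -> is_derive x 1 f (df x)) ->
  {within `[a, b], continuous f}.
Proof.
move=> fd; apply: continuous_in_subspaceT => x.
by rewrite inE /= in_itv /= => /fd /is_derive_continuous.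
Qed.

Lemma le_of_is_derive_ge0 f (df : R -> R) a b : a <= b ->
  (forall x, a <= x <= b -> is_derive x 1 f (df x)) ->
  (forall x, a <= x <= b -> 0 <= df x) -> f a <= f b.
Proof.
move=> ab fd df0; have fd' x : x \in `]a, b[%R -> is_derive x 1 f (df x).
  by move=> xab; apply: fd; rewrite !ltW ?(itvP xab).
have [c cab E] := MVT_segment ab fd' (is_derive_within_continuous fd).
by rewrite -subr_ge0 E mulr_ge0 ?subr_ge0// df0// ?(itvP cab).
Qed.

(** The primitive [p] of the bound makes both [p + f] and [p - f] nondecreasing. This comparison
    stands in for integrating [df], whose integrability is not assumed. *)
Lemma is_derive_power_bound f (df : R -> R) a b C n : a <= b ->
  (forall x, a <= x <= b -> is_derive x 1 f (df x)) ->
  (forall x, a <= x <= b -> `|df x| <= C * (x - a) ^+ n) ->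
  `|f b - f a| <= C * (b - a) ^+ n.+1 / n.+1%:R.
Proof.
move=> ab fd dfC; pose p x := C / n.+1%:R * (x - a) ^+ n.+1.
have pd x : is_derive x 1 p (C * (x - a) ^+ n).
  apply: (is_derive_eq (is_derive_scale (C / n.+1%:R) (is_derive_pow n.+1
    (is_derive_sub (is_derive_idfun x) (is_derive_const x a))))).
  by rewrite /= subr0 mulr1 mulrA divfK// pnatr_eq0.
have pa : p a = 0 by rewrite /p subrr expr0n /= mulr0.
have -> : C * (b - a) ^+ n.+1 / n.+1%:R = p b by rewrite /p mulrAC.
rewrite ler_norml; apply/andP; split.
- have : p a + f a <= p b + f b.
    have pf x (xab : a <= x <= b) := is_derive_add (pd x) (fd x xab).
    apply: (le_of_is_derive_ge0 ab pf) => x xab.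
    by have := dfC x xab; rewrite ler_norml; lra.
  by rewrite pa; lra.
- have : p a - f a <= p b - f b.
    have pf x (xab : a <= x <= b) := is_derive_sub (pd x) (fd x xab).
    apply: (le_of_is_derive_ge0 ab pf) => x xab.
    by have := dfC x xab; rewrite ler_norml; lra.
  by rewrite pa; lra.
Qed.

Lemma right_min_derive_ge0 f x d e : 0 < e -> is_derive x 1 f d ->
  (forall t, x <= t <= x + e -> f x <= f t) -> 0 <= d.
Proof.
move=> e0 [fx <-] fmin.
(* The derivative equals the limit of the difference quotients from the right, and these are
   nonnegative for increments below [e]. *)
rewrite ['D_1 f x]cvg_at_rightE; last exact: fx.
apply: limr_ge.
  rewrite -(cvg_at_rightE (fun h : R => h^-1 *: ((f \o shift x) _ - f x))) //.
  apply: cvg_trans fx; apply: cvg_app.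
  by move=> A [r r0 Ar]; exists r => // y yr y0; apply: Ar => //; exact: lt0r_neq0.
near=> h; have h0 : 0 < h by near: h; exact: nbhs_right_gt.
have he : h < e by near: h; exact: nbhs_right_lt.
apply: mulr_ge0; first by rewrite invr_ge0 ltW.
by rewrite subr_ge0 [_%:A]mulr1 /=; apply: fmin; lra.
Unshelve. all: by end_near. Qed.

(* Darboux: the signs of [df] at [a] and [b] prevent [f] from attaining its
   minimum over [a, b] at an endpoint. *)
Lemma derivative_zero f (df : R -> R) a b : a <= b ->
  (forall x, a <= x <= b -> is_derive x 1 f (df x)) ->
  df a < 0 -> 0 < df b -> exists2 z, a <= z <= b & df z = 0.
Proof.
move=> ab fd da db.
have ltab : a < b.
  rewrite lt_neqAle ab andbT; apply/eqP => E.
  by move: da; rewrite E ltNge (ltW db).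
have [c cab cmin] := EVT_min ab (is_derive_within_continuous fd).
have {}cmin t : a <= t <= b -> f c <= f t by move=> tab; apply: cmin; rewrite in_itv.
move: cab; rewrite in_itv /= => cab.
have ca : c != a.
  apply/eqP => E; subst c; have fa := fd a cab.
  suff : 0 <= df a by rewrite leNgt da.
  apply: (@right_min_derive_ge0 f a _ (b - a)) => //; first by rewrite subr_gt0.
  by move=> t tab; apply: cmin; lra.
have cb : c != b.
  apply/eqP => E; subst c; have fb := fd b cab.
  suff : 0 <= - df b by rewrite leNgt oppr_lt0 db.
  (* Reflection turns a minimum at the right endpoint [b] into one of [fun t => f (0 - t)] at the
     left endpoint [- b]. *)
  have /is_derive_comp_sub fb' : is_derive (0 - - b) 1 f (df b) by rewrite sub0r opprK.
  apply: (@right_min_derive_ge0 _ (- b) _ (b - a) _ fb'); first by rewrite subr_gt0.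
  by move=> t tab; rewrite !sub0r opprK; apply: cmin; lra.
have cI : c \in `]a, b[%R.
  by rewrite in_itv /= !lt_neqAle eq_sym ca cb.
exists c => //.
have [_ d0] : is_derive c 1 f 0.
  apply: (derive1_at_min ab _ cI) => t tI.
    by have [] : is_derive t 1 f (df t) by apply: fd; rewrite !ltW ?(itvP tI).
  by apply: cmin; rewrite !ltW ?(itvP tI).
by have [_ <-] := fd c cab; rewrite d0.
Qed.
End Derivatives.

(** * Error of Simpson's rule in terms of the second derivative *)

Section Simpson.
Context {R : realType}.
Set Implicit Arguments.
Unset Strict Implicit.
Implicit Types (f g F P : R -> R) (x a b c d h m p t al K : R).

(** The weights [2 * p] and [- p] are what remains of Simpson's rule on [0, 3p] once the trapezoid
    rule on [p, 3p] is removed. As a function of its right endpoint, the error has derivative at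
    most [2 * K * t ^+ 2] in absolute value. *)
Lemma left_piece_bound P F F1 K p : 0 <= p ->
  (forall t, 0 <= t <= p -> is_derive t 1 P (F t)) ->
  (forall t, 0 <= t <= p -> is_derive t 1 F (F1 t)) ->
  (forall t, 0 <= t <= p -> `|F1 t| <= K * t) ->
  `|2 * p * F 0 - p * F p - (P p - P 0)| <= 2 * K * p ^+ 3 / 3.
Proof.
move=> p0 dP dF F1K.
have FK t : 0 <= t <= p -> `|F t - F 0| <= K * t ^+ 2 / 2.
  move=> /andP[t0 tp]; have := @is_derive_power_bound _ F F1 0 t K 1 t0.
  rewrite subr0; apply=> x /andP[x0 xt]; first by apply: dF; lra.
  by rewrite subr0 expr1; apply: F1K; lra.
pose S t := 2 * F 0 * t - t * F t - (P t - P 0).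
have dS t : 0 <= t <= p -> is_derive t 1 S (2 * F 0 - 2 * F t - t * F1 t).
  move=> tp; rewrite /S.
  apply: (is_derive_eq (is_derive_sub (is_derive_sub
    (is_derive_scale (2 * F 0) (is_derive_idfun t))
    (is_derive_mul (is_derive_idfun t) (dF t tp)))
    (is_derive_sub (dP t tp) (is_derive_const t (P 0))))).
  by ring.
have := @is_derive_power_bound _ S _ 0 p (2 * K) 2 p0 dS.
have -> : S p - S 0 = 2 * p * F 0 - p * F p - (P p - P 0) by rewrite /S; ring.
rewrite subr0; apply=> t tp; rewrite subr0.
have := FK t tp; have := F1K t tp; rewrite !ler_norml => F1t Ft.
have t0 : 0 <= t by lra.
have : - (K * t ^+ 2) <= t * F1 t <= K * t ^+ 2.
  by move/andP: F1t => [A B]; apply/andP; split; nra.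
by lra.
Qed.

(** With the centre [al] fixed and the half-width [t] variable, the terms in [F] cancel in the
    derivative of the error, leaving [t * (F1 (al + t) - F1 (al - t))]. *)
Lemma trapezoid_bound P F F1 F2 K al p : 0 <= p ->
  (forall t, al - p <= t <= al + p -> is_derive t 1 P (F t)) ->
  (forall t, al - p <= t <= al + p -> is_derive t 1 F (F1 t)) ->
  (forall t, al - p <= t <= al + p -> is_derive t 1 F1 (F2 t)) ->
  (forall t, al - p <= t <= al + p -> `|F2 t| <= K) ->
  `|p * (F (al + p) + F (al - p)) - (P (al + p) - P (al - p))| <= 2 * K * p ^+ 3 / 3.
Proof.
move=> p0 dP dF dF1 F2K.
pose S t := t * (F (al + t) + F (al - t)) - (P (al + t) - P (al - t)).
have dS t : 0 <= t <= p -> is_derive t 1 S (t * (F1 (al + t) - F1 (al - t))).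
  move=> /andP[t0 tp]; rewrite /S.
  have tr : al - p <= al + t <= al + p by lra.
  have tl : al - p <= al - t <= al + p by lra.
  apply: (is_derive_eq (is_derive_sub (is_derive_mul (is_derive_idfun t)
    (is_derive_add (is_derive_comp_add (dF _ tr)) (is_derive_comp_sub (dF _ tl))))
    (is_derive_sub (is_derive_comp_add (dP _ tr)) (is_derive_comp_sub (dP _ tl))))).
  by ring.
have := @is_derive_power_bound _ S _ 0 p (2 * K) 2 p0 dS.
have -> : S p - S 0 = p * (F (al + p) + F (al - p)) - (P (al + p) - P (al - p)).
  by rewrite /S addr0 subr0; ring.
rewrite subr0; apply=> t /andP[t0 tp]; rewrite subr0 normrM ger0_norm//.
have tt : al - t <= al + t by lra.
have : `|F1 (al + t) - F1 (al - t)| <= K * (2 * t).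
  have := @is_derive_power_bound _ F1 F2 (al - t) (al + t) K 0 tt.
  rewrite expr1 divr1 (_ : al + t - (al - t) = 2 * t); last by ring.
  apply=> x /andP[x0 xt]; first by apply: dF1; lra.
  by rewrite expr0 mulr1; apply: F2K; lra.
by move=> A; nra.
Qed.

(* Integrating by parts, the error is the integral of [(t - 2h/3) F' t] over
   [0, h]; the Peano kernel of [F''] changes sign at [h/3]. *)
Lemma even_simpson_bound P F F1 F2 K h : 0 <= h ->
  (forall t, 0 <= t <= h -> is_derive t 1 P (F t)) ->
  (forall t, 0 <= t <= h -> is_derive t 1 F (F1 t)) ->
  (forall t, 0 <= t <= h -> is_derive t 1 F1 (F2 t)) ->
  F1 0 = 0 -> (forall t, 0 <= t <= h -> `|F2 t| <= K) ->
  `|h * (F h + 2 * F 0) / 3 - (P h - P 0)| <= 4 * K * h ^+ 3 / 81.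
Proof.
move=> h0 dP dF dF1 F10 F2K; pose p := h / 3; have hp : h = 3 * p by rewrite /p; lra.
have p0 : 0 <= p by lra.
have sub t : 0 <= t <= p -> 0 <= t <= h by move=> tp; lra.
have sub2 t : 2 * p - p <= t <= 2 * p + p -> 0 <= t <= h by move=> tp; lra.
have F1K t : 0 <= t <= p -> `|F1 t| <= K * t.
  move=> /andP[t0 tp]; have := @is_derive_power_bound _ F1 F2 0 t K 0 t0.
  rewrite !subr0 F10 subr0 expr1 divr1; apply=> x /andP[x0 xt].
    by apply: dF1; lra.
  by rewrite expr0 mulr1; apply: F2K; lra.
(* The left piece covers [0, p], the trapezoid rule [p, 3p]; the values at [p] cancel in the sum.
   Each piece contributes [2 * K * p ^+ 3 / 3]. *)
have A := left_piece_bound p0 (fun t tp => dP t (sub t tp))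
  (fun t tp => dF t (sub t tp)) F1K.
have B := @trapezoid_bound P F F1 F2 K (2 * p) p p0 (fun t tp => dP t (sub2 t tp))
  (fun t tp => dF t (sub2 t tp)) (fun t tp => dF1 t (sub2 t tp))
  (fun t tp => F2K t (sub2 t tp)).
move: B; have -> : 2 * p + p = h by rewrite hp; ring.
have -> : 2 * p - p = p by ring.
move=> B; apply: (le_trans _ (_ : 2 * K * p ^+ 3 / 3 + 2 * K * p ^+ 3 / 3 <= _)); last first.
  by rewrite /p le_eqVlt; apply/orP; left; apply/eqP; field.
apply: le_trans (lerD A B); apply: le_trans (ler_normD _ _).
by rewrite le_eqVlt; apply/orP; left; apply/eqP; congr Num.norm; rewrite hp; field.
Qed.

Lemma even_simpson_bound_centered P F F1 F2 c K h : 0 <= h ->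
  (forall t, 0 <= t <= h -> is_derive t 1 P (F t)) ->
  (forall t, 0 <= t <= h -> is_derive t 1 F (F1 t)) ->
  (forall t, 0 <= t <= h -> is_derive t 1 F1 (F2 t)) ->
  F1 0 = 0 -> (forall t, 0 <= t <= h -> `|F2 t - c| <= K) ->
  `|h * (F h + 2 * F 0) / 3 - (P h - P 0)| <= 4 * K * h ^+ 3 / 81.
Proof.
move=> h0 dP dF dF1 F10 F2K.
have dpow (k : R) n t :
    is_derive t 1 (fun t : R => k * t ^+ n) (k * (n%:R * t ^+ n.-1)).
  apply: (is_derive_eq (is_derive_scale k (is_derive_pow n (is_derive_idfun t)))).
  by rewrite mulr1.
(* The rule is exact on [t ^+ 2], so the corrections to [F] and to its primitive cancel in the error
   while [F2] is shifted by [c]. *)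
have := @even_simpson_bound (fun t => P t - c / 6 * t ^+ 3)
  (fun t => F t - c / 2 * t ^+ 2) (fun t => F1 t - c * t ^+ 1) (fun t => F2 t - c) K h h0.
set A := (X in (_ -> _ -> _ -> _ -> _ -> `|X| <= _) -> _).
have -> : A = h * (F h + 2 * F 0) / 3 - (P h - P 0) by rewrite /A; field.
apply.
- by move=> t th; apply: (is_derive_eq (is_derive_sub (dP t th) (dpow _ 3 t))) => /=; field.
- by move=> t th; apply: (is_derive_eq (is_derive_sub (dF t th) (dpow _ 2 t))) => /=; field.
- by move=> t th; apply: (is_derive_eq (is_derive_sub (dF1 t th) (dpow _ 1 t))) => /=; ring.
- by rewrite F10 expr1 mulr0 subrr.
- exact: F2K.
Qed.

(** Folding at [m] replaces [f] by the even function [f (m + t) + f (m - t)], whose first derivative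
    vanishes at 0. *)
Lemma simpson_bound P f f1 f2 m h c K : 0 <= h ->
  (forall t, m - h <= t <= m + h -> is_derive t 1 P (f t)) ->
  (forall t, m - h <= t <= m + h -> is_derive t 1 f (f1 t)) ->
  (forall t, m - h <= t <= m + h -> is_derive t 1 f1 (f2 t)) ->
  (forall t, 0 <= t <= h -> `|f2 (m + t) + f2 (m - t) - c| <= K) ->
  `|h * (f (m + h) + f (m - h) + 4 * f m) / 3 - (P (m + h) - P (m - h))|
    <= 4 * K * h ^+ 3 / 81.
Proof.
move=> h0 dP df df1 f2K.
have r t : 0 <= t <= h -> m - h <= m + t <= m + h by move=> ?; lra.
have l t : 0 <= t <= h -> m - h <= m - t <= m + h by move=> ?; lra.
have := @even_simpson_bound_centered (fun t => P (m + t) - P (m - t))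
  (fun t => f (m + t) + f (m - t)) (fun t => f1 (m + t) - f1 (m - t))
  (fun t => f2 (m + t) + f2 (m - t)) c K h h0.
rewrite addr0 subr0 !subrr.
set A := (X in (_ -> _ -> _ -> _ -> _ -> `|X| <= _) -> _).
have -> : A = h * (f (m + h) + f (m - h) + 4 * f m) / 3 - (P (m + h) - P (m - h)).
  by rewrite /A; field.
apply=> //.
- move=> t th; apply: (is_derive_eq (is_derive_sub (is_derive_comp_add (dP _ (r t th)))
    (is_derive_comp_sub (dP _ (l t th))))); ring.
- move=> t th; apply: (is_derive_eq (is_derive_add (is_derive_comp_add (df _ (r t th)))
    (is_derive_comp_sub (df _ (l t th))))); ring.
- move=> t th; apply: (is_derive_eq (is_derive_sub (is_derive_comp_add (df1 _ (r t th)))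
    (is_derive_comp_sub (df1 _ (l t th))))); ring.
Qed.
End Simpson.

(** * Sign structure of the second derivative and consequences of P-convexity *)

Section Oscillation.
Context {R : realType}.
Set Implicit Arguments.
Unset Strict Implicit.
Implicit Types (g : R -> R) (a b c h m t u v x y z K : R).

(** The intermediate value property at level 0. It is the substitute for continuity, which a second
    derivative may lack. *)
Definition has_zero_crossings g a b := forall x y,
  a <= x <= b -> a <= y <= b -> x <= y -> g x * g y < 0 ->
  exists2 z, x <= z <= y & g z = 0.

Definition monotone_norm_from_zeros g a b := forall z x y,
  a <= z <= b -> a <= y <= b -> g z = 0 -> z <= x <= y \/ y <= x <= z ->
  `|g x| <= `|g y|.

(** Some zero [z] lies between [u] and [v]. Then [g] is nonnegative to its left and nonpositive to
    its right, and growth of the norm away from [z] makes [g] nonincreasing on each side. *)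
Lemma nonincreasing_at_midpoint g m h u v t :
  has_zero_crossings g (m - h) (m + h) ->
  monotone_norm_from_zeros g (m - h) (m + h) ->
  m - h <= u <= m + h -> m - h <= v <= m + h -> u <= v -> 0 < g u -> g v < 0 ->
  0 <= t <= h -> g (m + t) <= g m <= g (m - t).
Proof.
move=> gZ gM uJ vJ uv gu gv th.
have [z zuv gz] : exists2 z, u <= z <= v & g z = 0 by apply: gZ => //; nra.
have zJ : m - h <= z <= m + h by lra.
have between w x y : m - h <= w <= m + h -> m - h <= y <= m + h ->
    g w = 0 -> g y = 0 -> w <= x <= y -> g x = 0.
  move=> wJ yJ gw gy wxy; apply/eqP; rewrite -normr_le0.
  by have := gM w x y wJ yJ gw (or_introl wxy); rewrite gy normr0.
(* A negative value at [x] would force a further zero [w] between [x] and [u]. Then [u] or [x] lies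
   between the zeros [w] and [z], where [g] vanishes. *)
have nonneg x : m - h <= x -> x <= z -> 0 <= g x.
  move=> hx xz; rewrite leNgt; apply/negP => gx.
  have xJ : m - h <= x <= m + h by lra.
  have [xu|ux] := leP x u.
    have [|w wxu gw] := gZ x u xJ uJ xu; first by nra.
    have : g u = 0 by apply: (between w u z) => //; lra.
    by lra.
  have [|w wxu gw] := gZ u x uJ xJ (ltW ux); first by nra.
  have : g x = 0 by apply: (between w x z) => //; lra.
  by lra.
have nonpos x : z <= x -> x <= m + h -> g x <= 0.
  move=> zx hx; rewrite leNgt; apply/negP => gx.
  have xJ : m - h <= x <= m + h by lra.
  have [vx|xv] := leP v x.
    have [|w wvx gw] := gZ v x vJ xJ vx; first by nra.
    have : g v = 0 by apply: (between z v w) => //; lra.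
    by lra.
  have [|w wvx gw] := gZ x v xJ vJ (ltW xv); first by nra.
  have : g x = 0 by apply: (between z x w) => //; lra.
  by lra.
have lJ : m - h <= m - t <= m + h by lra.
have mJ : m - h <= m <= m + h by lra.
have rJ : m - h <= m + t <= m + h by lra.
(* Points on the same side of [z] are compared by norms, points on opposite sides by signs. *)
have [mz|/ltW zm] := leP m z.
  have gm : 0 <= g m by apply: nonneg => //; lra.
  have gl : 0 <= g (m - t) by apply: nonneg; lra.
  have : `|g m| <= `|g (m - t)| by apply: (gM z) => //; right; lra.
  rewrite !ger0_norm// => ->; rewrite andbT.
  have [rz|/ltW zr] := leP (m + t) z.
    have gr : 0 <= g (m + t) by apply: nonneg; lra.
    have : `|g (m + t)| <= `|g m| by apply: (gM z) => //; right; lra.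
    by rewrite !ger0_norm.
  by apply: le_trans gm; apply: nonpos; lra.
have gm : g m <= 0 by apply: nonpos => //; lra.
have gr : g (m + t) <= 0 by apply: nonpos; lra.
have : `|g m| <= `|g (m + t)| by apply: (gM z) => //; left; lra.
rewrite !ler0_norm// lerN2 => -> /=.
have [lz|/ltW zl] := leP (m - t) z.
  by apply: (le_trans gm); apply: nonneg; lra.
have gl : g (m - t) <= 0 by apply: nonpos; lra.
have : `|g (m - t)| <= `|g m| by apply: (gM z) => //; left; lra.
by rewrite !ler0_norm// lerN2.
Qed.

(* The a priori oscillation of [g (m + t) + g (m - t)] is [4 K], not [2 K]. *)
Lemma symmetrized_oscillation g m h K :
  has_zero_crossings g (m - h) (m + h) ->
  monotone_norm_from_zeros g (m - h) (m + h) ->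
  (forall x, m - h <= x <= m + h -> `|g x| <= K) ->
  exists c, forall t, 0 <= t <= h -> `|g (m + t) + g (m - t) - c| <= K.
Proof.
move=> gZ gM gK.
have gNZ : has_zero_crossings (fun x => - g x) (m - h) (m + h).
  move=> x y xJ yJ xy; rewrite mulrNN => /(gZ x y xJ yJ xy)[z zxy gz].
  by exists z; rewrite // gz oppr0.
have gNM : monotone_norm_from_zeros (fun x => - g x) (m - h) (m + h).
  move=> z x y zJ yJ /eqP; rewrite oppr_eq0 !normrN => /eqP; exact: gM.
have KJ t : 0 <= t <= h ->
    [/\ - K <= g (m + t), g (m + t) <= K, - K <= g (m - t) & g (m - t) <= K].
  move=> th; have /gK : m - h <= m + t <= m + h by lra.
  have /gK : m - h <= m - t <= m + h by lra.
  by rewrite !ler_norml => /andP[? ?] /andP[? ?].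
have [[u uJ gu]|npos] := pselect (exists2 u, m - h <= u <= m + h & 0 < g u);
  have [[v vJ gv]|nneg] := pselect (exists2 v, m - h <= v <= m + h & g v < 0).
(* Both signs occur: [g m] lies between [g (m - t)] and [g (m + t)], so the sum minus [g m] does
   too. If the negative value comes first, [- g] is used. *)
- exists (g m) => t th; have [? ? ? ?] := KJ t th; rewrite ler_norml.
  have [uv|/ltW vu] := leP u v.
    by have := nonincreasing_at_midpoint gZ gM uJ vJ uv gu gv th; lra.
  have := @nonincreasing_at_midpoint _ m h v u t gNZ gNM vJ uJ vu.
  by rewrite oppr_gt0 oppr_lt0 => /(_ gv gu th); lra.
(* With [g] nonnegative the sum lies in [0, 2K], whose centre is [K]; the nonpositive cases below
   are symmetric. *)
- exists K => t th; have [? ? ? ?] := KJ t th; rewrite ler_norml.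
  have ge0 x : m - h <= x <= m + h -> 0 <= g x.
    by move=> xJ; rewrite leNgt; apply/negP => gx; apply: nneg; exists x.
  have : 0 <= g (m + t) by apply: ge0; lra.
  have : 0 <= g (m - t) by apply: ge0; lra.
  lra.
all: exists (- K) => t th; have [? ? ? ?] := KJ t th; rewrite ler_norml.
all: have le0 x : m - h <= x <= m + h -> g x <= 0
  by move=> xJ; rewrite leNgt; apply/negP => gx; apply: npos; exists x.
all: have : g (m + t) <= 0 by apply: le0; lra.
all: have : g (m - t) <= 0 by apply: le0; lra.
all: lra.
Qed.

Lemma powR_le_inv (u s q : R) : 0 < q -> 0 <= u -> u `^ q <= s -> u <= s `^ q^-1.
Proof.
move=> q0 u0 us; rewrite -[u in u <= _]powRr1// -(mulfV (lt0r_neq0 q0)) powRrM.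
have s0 : 0 <= s := le_trans (powR_ge0 _ _) us.
by apply: ge0_ler_powR; rewrite ?nnegrE ?powR_ge0// invr_ge0 ltW.
Qed.

Lemma P_convex_le g a b x y z : P_convex `[a, b]%R g ->
  a <= y <= b -> a <= z <= b -> y <= x <= z -> g x <= g y + g z.
Proof.
move=> [g0 gP] yJ zJ /andP[yx xz].
have [yz|yz] := eqVneq y z.
  have -> : x = z by lra.
  by rewrite lerDr; apply: g0; rewrite in_itv.
have yz0 : 0 < z - y by rewrite subr_gt0 lt_neqAle yz (le_trans yx xz).
(* Barycentric coordinates of [x] in [y, z], available once [y] and [z] differ. *)
have E : x = (z - x) / (z - y) * y + (1 - (z - x) / (z - y)) * z.
  by field; rewrite gt_eqF.
rewrite {1}E; apply: gP; rewrite ?in_itv//=.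
by rewrite divr_ge0 ?ler_pdivrMr ?subr_ge0 ?mul1r ?(ltW yz0)//=; lra.
Qed.

(** When one endpoint is a zero of [g], its term in the P-convexity inequality drops out, and q-th
    roots can be taken. *)
Lemma P_convex_powR_monotone_norm g a b q : 0 < q ->
  P_convex `[a, b]%R (fun x => `|g x| `^ q) -> monotone_norm_from_zeros g a b.
Proof.
move=> q0 gP z x y zJ yJ gz xyz.
have : `|g x| `^ q <= `|g y| `^ q.
  have : `|g x| `^ q <= `|g z| `^ q + `|g y| `^ q.
    by case: xyz => [/(P_convex_le gP zJ yJ)//|/(P_convex_le gP yJ zJ)]; rewrite addrC.
  (* Positivity of [q] matters here, as 0 to the power 0 is 1. *)
  by rewrite gz normr0 powR0 ?add0r// gt_eqF.
move=> /(powR_le_inv q0 (normr_ge0 _)).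
by rewrite -powRrM mulfV ?gt_eqF// powRr1.
Qed.

Lemma is_derive_has_zero_crossings g (dg : R -> R) a b :
  (forall x, a <= x <= b -> is_derive x 1 g (dg x)) -> has_zero_crossings dg a b.
Proof.
move=> gd x y xJ yJ xy; have gd' t : x <= t <= y -> is_derive t 1 g (dg t).
  by move=> ?; apply: gd; lra.
have [dx|dx|->] := ltgtP (dg x) 0; last by rewrite mul0r ltxx.
  by rewrite nmulr_rlt0// => dy; exact: (derivative_zero xy gd').
(* A change from positive to negative is reduced to [derivative_zero] by passing to [- g]. *)
rewrite pmulr_rlt0// => dy.
have gNd t (txy : x <= t <= y) := is_derive_opp (gd' t txy).
have [||z zxy /eqP] := derivative_zero xy gNd; rewrite ?oppr_gt0 ?oppr_lt0//.
by rewrite oppr_eq0 => /eqP; exists z.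
Qed.
End Oscillation.

(** * Interior of the interval and the fundamental theorem of calculus *)

Section Integral.
Context {R : realType}.
Set Implicit Arguments.
Unset Strict Implicit.
Implicit Types (f : R -> R) (a b x y : R).

Lemma interior_itv_conv (I : interval R) a b x :
  [set` I]° a -> [set` I]° b -> a <= x <= b -> [set` I]° x.
Proof.
move=> Ia Ib; rewrite !le_eqVlt => /andP[/predU1P[<-//|ax] /predU1P[->//|xb]].
have xab : x \in `]a, b[%R by rewrite in_itv/= ax.
apply: filterS (near_in_itvoo xab) => y /=; rewrite in_itv/= => /andP[ay yb].
apply: (interval_is_interval (interior_subset Ia) (interior_subset Ib)).
by rewrite !ltW.
Qed.

Lemma interior_itv_enlarge (I : interval R) a b :
  [set` I]° a -> [set` I]° b -> exists a' b',
  [/\ a' < a, b < b' & forall x, a' <= x <= b' -> [set` I]° x].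
Proof.
move=> Ia Ib.
have nbhsI y : [set` I]° y -> \forall z \near y, [set` I]° z.
  by move=> Iy; exact: open_nbhs_nbhs (conj (open_interior _) Iy).
have /nbhs_ballP[/= r r0 ra] := nbhsI _ Ia.
have /nbhs_ballP[/= s s0 sb] := nbhsI _ Ib.
exists (a - r / 2), (b + s / 2); split; [by rewrite ltrBlDr ltrDl divr_gt0|by rewrite ltrDl divr_gt0|].
move=> x; apply: interior_itv_conv.
  by apply: ra; rewrite /ball/= ltr_norml; lra.
by apply: sb; rewrite /ball/= ltr_norml; lra.
Qed.

(** Integrating from [a'] instead of [a], with room up to [b'], makes [P] differentiable from both
    sides even at [a] and [b]. *)
Lemma exists_antiderivative f a b a' b' : a' < a -> a < b -> b < b' ->
  (forall x, a' <= x <= b' -> {for x, continuous f}) ->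
  exists2 P : R -> R, (forall x, a <= x <= b -> is_derive x 1 P (f x)) &
    (\int[@lebesgue_measure R]_(x in `[a, b]) f x) = P b - P a.
Proof.
move=> a'a ab bb' fc.
have within c d : a' <= c -> d <= b' -> {within `[c, d], continuous f}.
  move=> ac db; apply: continuous_in_subspaceT => x.
  by rewrite inE/= in_itv/= => xcd; apply: fc; lra.
have fi : (@lebesgue_measure R).-integrable `[a', b'] (EFin \o f).
  by apply: continuous_compact_integrable; [exact: segment_compact|exact: within].
pose P x := \int[@lebesgue_measure R]_(t in `[a', x]) f t.
have dP x : a <= x <= b -> is_derive x 1 P (f x).
  move=> xab.
  have xb' : x < b' by lra.
  have a'x : a' < x by lra.
  have fx : {for x, continuous f} by apply: fc; rewrite !ltW.
  have [d <-] : derivable P x 1 /\ P^`() x = f x := continuous_FTC1_closed xb' fi a'x fx.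
  exact: derivable_is_derive1.
exists P => //.
rewrite /Rintegral (@continuous_FTC2 _ f P a b)//.
- by apply: within; exact: ltW.
- split.
  + by move=> x /[!in_itv]/= xab; have [] : is_derive x 1 P (f x) by apply: dP; lra.
  + by apply: cvg_at_right_filter; apply: (is_derive_continuous (dP a _)); rewrite lexx ltW.
  + by apply: cvg_at_left_filter; apply: (is_derive_continuous (dP b _)); rewrite lexx ltW.
- move=> x /[!in_itv]/= xab.
  by rewrite derive1E; have [] : is_derive x 1 P (f x) by apply: dP; lra.
Qed.
End Integral.

(** * Combination of the quadrature bound with the oscillation bound *)

Theorem corollary3 (R : realType) (I : interval R) (f : R -> R) (a b q : R)
  (hf : twice_derivable_on ([set` I]°) f)
  (ha : ([set` I]°) a) (hb : ([set` I]°) b) (hab : a < b)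
  (hq : 1 <= q)
  (hP : P_convex `[a, b]%R (fun x => `|f^`(2) x| `^ q)) :
  `| 3^-1 * ((f a + f b) / 2 + 2 * f ((a + b) / 2))
     - (b - a)^-1 * (\int[@lebesgue_measure R]_(x in `[a, b]) f x) |
  <= (b - a) ^+ 2 / 162
     * (`|f^`(2) a| `^ q + `|f^`(2) b| `^ q) `^ (q^-1).
Proof.
have q0 : 0 < q by apply: lt_le_trans hq.
have [a' [b' [a'a bb' sub]]] := interior_itv_enlarge ha hb.
have df (x : R) : a' <= x <= b' -> is_derive x 1 f (f^`() x).
  by move=> /sub /hf[fx _]; exact: derivable_is_derive1.
have df1 (x : R) : a' <= x <= b' -> is_derive x 1 f^`() (f^`(2) x).
  by move=> /sub /hf[_ fx]; exact: (derivable_is_derive1 fx).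
have [P dP ->] := exists_antiderivative a'a hab bb'
  (fun x xI => is_derive_continuous (df x xI)).
set m := (a + b) / 2; set K := _ `^ q^-1.
pose h := (b - a) / 2; have h0 : 0 < h by rewrite divr_gt0// subr_gt0.
have am : a = m - h by rewrite /m /h; field.
have bm : b = m + h by rewrite /m /h; field.
have J (x : R) : m - h <= x <= m + h -> a' <= x <= b' by move=> ?; lra.
(* P-convexity between the endpoints [a] and [b], followed by a q-th root. *)
have f2K (x : R) : m - h <= x <= m + h -> `|f^`(2) x| <= K.
  rewrite -am -bm => xJ; apply: powR_le_inv => //.
  by apply: (P_convex_le hP) => //; rewrite lexx ltW.
have f2Z : has_zero_crossings f^`(2) (m - h) (m + h).
  exact: (is_derive_has_zero_crossings (fun x xJ => df1 x (J x xJ))).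
have f2M : monotone_norm_from_zeros f^`(2) (m - h) (m + h).
  by rewrite -am -bm; exact: P_convex_powR_monotone_norm hP.
have [c f2c] := symmetrized_oscillation f2Z f2M f2K.
rewrite am bm in dP *.
have := simpson_bound (ltW h0) dP (fun t tJ => df t (J t tJ))
  (fun t tJ => df1 t (J t tJ)) f2c.
have -> : m + h - (m - h) = 2 * h by ring.
set S := (X in `|X| <= _ -> _) => SK.
set E := (X in `|X| <= _).
(* Dividing [4 * K * h ^+ 3 / 81] by the length [2 * h] gives [(2 * h) ^+ 2 / 162 * K]. *)
have -> : E = S / (2 * h) by rewrite /E /S; field; rewrite gt_eqF.
have h2 : 0 < 2 * h by lra.
rewrite normrM normfV (gtr0_norm h2) ler_pdivrMr//.
by apply: (le_trans SK); rewrite le_eqVlt; apply/orP; left; apply/eqP; field.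
Qed.
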